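(* Let $G$ be a complete $r$-partite graph for some $r\geq 2$, and let $H$ be a subgraph of $G$. Then $H$ contains a connected component $H'$ satisfying \[ |E(H')|\geq \frac{|E(H)|^2}{|E(G)|}. \]
   Context: All graphs are finite and simple, and $H$ has at least one vertex. A complete $r$-partite graph is a graph whose vertex set is partitioned into $r$ nonempty independent sets (parts), with every two vertices in different parts adjacent. A subgraph need not be induced. *)

(* Defs.v *)
From HB Require Import structures.
From mathcomp Require Import all_boot all_order all_algebra.

Set Implicit Arguments.
Unset Strict Implicit.
Unset Printing Implicit Defensive.

(* A finite simple graph whose vertices form a subset of the finite type [V],
   so that a graph and its subgraphs all have type [graph V].  An edge is the
   unordered pair of its ends, i.e. a 2-element set of vertices. *)
Record graph (V : finType) := Graph {
  verts : {set V};
  edges : {set {set V}};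
  edges_subproof :
    [forall e in edges, (e \subset verts) && (#|e| == 2)] }.

Section Graphs.
Variable V : finType.
Implicit Types (G H K : graph V).

Definition adj G : rel V := [rel x y | [set x; y] \in edges G].

Definition subgraph H G : bool :=
  (verts H \subset verts G) && (edges H \subset edges G).

Definition independent G (A : {set V}) : bool :=
  [forall x in A, forall y in A, ~~ adj G x y].

(* [partition P (verts G)] already requires the members of [P] to be nonempty. *)
Definition is_parts G (P : {set {set V}}) : bool :=
  [&& partition P (verts G),
      [forall A in P, independent G A] &
      [forall A in P, forall B in P, (A != B) ==>
         [forall x in A, forall y in B, adj G x y]]].

Definition complete_multipartite (r : nat) G : Prop :=
  exists P : {set {set V}}, is_parts G P /\ #|P| = r.

Definition connected_graph G : bool :=
  (verts G != set0) &&
  [forall x in verts G, forall y in verts G, connect (adj G) x y].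

(* A connected component is a maximal connected subgraph. *)
Definition is_component H' H : Prop :=
  [/\ subgraph H' H, connected_graph H' &
      forall K, subgraph K H -> connected_graph K ->
        subgraph H' K -> subgraph K H'].

End Graphs.

(* Main.v *)
(* Let A_1, ..., A_k be the vertex sets of the components of H and let N(A, B)
   be the number of pairs of A x B adjacent in G.  In terms of the numbers of
   vertices in each part of G, N is the Lorentzian form
   |a||b| - <a, b>, with |a| the sum of the entries of a, and it is negative
   semidefinite on the vectors with |a| = 0.  Applied to |b| a - |a| b this
   gives |b|^2 N(A, A) + |a|^2 N(B, B) <= 2 |a||b| N(A, B), and hence
   min(N(A, A), N(B, B)) <= N(A, B).  If x_i is twice the number of edges of
   the i-th component and M is the largest x_i, then x_i <= N(A_i, A_i), so
     M * 2|E(G)| >= sum_{i,j} M min(x_i, x_j) >= sum_{i,j} x_i x_j = (2|E(H)|)^2. *)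
Require Import Defs.
From HB Require Import structures.
From mathcomp Require Import all_boot all_order all_algebra.
From mathcomp Require Import zify ring lra.

Set Implicit Arguments.
Unset Strict Implicit.
Unset Printing Implicit Defensive.

Import Order.TTheory GRing.Theory Num.Theory.
Local Open Scope ring_scope.

(** * Counting pairs of vertices in different classes *)

Lemma sum_ind_eq (R : pzSemiRingType) (T : finType) (i j : T) :
  \sum_(t : T) (i == t)%:R * (j == t)%:R = (i == j)%:R :> R.
Proof.
rewrite (bigD1 i) //= eqxx mul1r big1 ?addr0 1?eq_sym // => t /negPf t_i.
by rewrite [i == t]eq_sym t_i mul0r.
Qed.

Section CrossPairs.
Variables (V T : finType) (c : V -> T).
Implicit Types A B : {set V}.

Definition class_card A (t : T) : int := \sum_(x in A) (c x == t)%:R.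

(** All pairs minus the pairs in a common class; the latter give an inner product because
    [c x == c y] is the sum over [t] of the products of the indicators of [c x == t] and [c y == t].
    With [c] sending a vertex to its part, this is the Lorentzian form. *)
Lemma sum_neq_class A B :
  ((\sum_(x in A) \sum_(y in B) (c x != c y))%N)%:Z
    = #|A|%:Z * #|B|%:Z - \sum_t class_card A t * class_card B t.
Proof.
have -> : \sum_t class_card A t * class_card B t
    = \sum_(x in A) \sum_(y in B) (c x == c y)%:R.
  under eq_bigr => t _ do rewrite /class_card big_distrlr /=.
  rewrite exchange_big; apply: eq_bigr => x _ /=.
  by rewrite exchange_big; apply: eq_bigr => y _; rewrite sum_ind_eq.
have -> : #|A|%:Z * #|B|%:Z = \sum_(x in A) \sum_(y in B) 1.
  by rewrite !sumr_const -mulrnA mulnC -PoszM -natz.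
rewrite -sumrB -natz natr_sum; apply: eq_bigr => x _.
rewrite -sumrB natr_sum; apply: eq_bigr => y _.
by case: (c x == c y).
Qed.

Lemma minn_sum_neq A B :
  (minn (\sum_(x in A) \sum_(y in A) (c x != c y))
        (\sum_(x in B) \sum_(y in B) (c x != c y))
    <= \sum_(x in A) \sum_(y in B) (c x != c y))%N.
Proof.
have [->|A0] := eqVneq A set0; first by rewrite [X in minn X _]big_set0 min0n.
have := sum_neq_class A A; have := sum_neq_class B B.
have := sum_neq_class A B.
have S_gt0 : 0 < #|A|%:Z by rewrite ltz_nat card_gt0.
move: (\sum_(x in A) \sum_(y in B) _)%N (\sum_(x in A) \sum_(y in A) _)%N
      (\sum_(x in B) \sum_(y in B) _)%N => Z X Y.
set p := \sum_t _; set q := \sum_t _; set s := \sum_t _ => EZ EY EX.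
(* This is the squared norm of |b| a - |a| b. The coordinates of that vector sum to zero, so in
   [main] the terms in [#|A| ^ 2 * #|B| ^ 2] cancel. *)
have sq_ge0 : 0 <= #|B|%:Z ^+ 2 * s + #|A|%:Z ^+ 2 * q
                 - 2 * #|A|%:Z * #|B|%:Z * p.
  suff -> : #|B|%:Z ^+ 2 * s + #|A|%:Z ^+ 2 * q - 2 * #|A|%:Z * #|B|%:Z * p
      = \sum_t (#|B|%:Z * class_card A t - #|A|%:Z * class_card B t) ^+ 2.
    by apply: sumr_ge0 => t _; apply: sqr_ge0.
  rewrite !mulr_sumr -big_split -sumrB; apply: eq_bigr => t _ /=; ring.
have main : #|B|%:Z ^+ 2 * X%:Z + #|A|%:Z ^+ 2 * Y%:Z
              <= 2 * #|A|%:Z * #|B|%:Z * Z%:Z.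
  rewrite EX EY EZ; nra.
(* If both X and Y were at least Z + 1, [main] would give (S^2 + U^2)(Z + 1) <= 2SUZ, against (S -
   U)^2 Z >= 0 and S > 0. *)
rewrite leqNgt leq_min; apply/negP => /andP[ZX ZY].
have ZX' : Z%:Z + 1 <= X%:Z by lia.
have ZY' : Z%:Z + 1 <= Y%:Z by lia.
have Z0 : 0 <= Z%:Z by lia.
move: main S_gt0; set S := #|A|%:Z; set U := #|B|%:Z => main S_gt0.
have hX : 0 <= U ^+ 2 * (X%:Z - Z%:Z - 1) by apply: mulr_ge0; [exact: sqr_ge0|lia].
have hY : 0 <= S ^+ 2 * (Y%:Z - Z%:Z - 1) by apply: mulr_ge0; [exact: sqr_ge0|lia].
have hZ : 0 <= (S - U) ^+ 2 * Z%:Z by apply: mulr_ge0; [exact: sqr_ge0|].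
have S2 : 0 < S ^+ 2 by exact: exprn_gt0.
have U2 : 0 <= U ^+ 2 by exact: sqr_ge0.
nra.
Qed.

End CrossPairs.

(** * Edge counts, connected components and parts *)

Section GraphLemmas.
Variable V : finType.
Implicit Types (G H K : graph V).

Lemma adj_sym G : symmetric (adj G).
Proof. by move=> x y; rewrite /adj /= setUC. Qed.

Lemma edge_sub G e : e \in edges G -> e \subset verts G.
Proof. by move=> eG; have /forall_inP/(_ e eG)/andP[] := edges_subproof G. Qed.

Lemma card_edge G e : e \in edges G -> #|e| = 2%N.
Proof.
by move=> eG; have /forall_inP/(_ e eG)/andP[_ /eqP] := edges_subproof G.
Qed.

Lemma adj_verts G x y : adj G x y -> (x \in verts G) && (y \in verts G).
Proof. by move=> /edge_sub; rewrite subUset !sub1set. Qed.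

Lemma card_ordered_pairs (e : {set V}) : #|e| = 2%N ->
  (\sum_(p : V * V | [set p.1; p.2] == e) 1 = 2)%N.
Proof.
move/eqP/cards2P => [a [b [ab ->]]].
rewrite sum1_card.
have <- : #|[set (a, b); (b, a)]| = 2%N by rewrite cards2 xpair_eqE negb_and ab.
apply: eq_card => -[x y]; rewrite in_set2 -[LHS]/([set x; y] == [set a; b]).
apply/eqP/orP => [exy|[]/eqP[-> ->] //]; last by rewrite setUC.
apply/orP.
(* Both x and y lie in {a, b}, and x = y is impossible since a and b both lie in {x, y}. *)
have := set21 x y; have := set22 x y; rewrite exy.
have := set21 a b; have := set22 a b; rewrite -{1 2}exy !inE !xpair_eqE.
move=> hb ha /orP[]/eqP hy /orP[]/eqP hx; subst.
- by rewrite orbb eq_sym (negPf ab) in hb.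
- by rewrite !eqxx orbT.
- by rewrite !eqxx.
- by rewrite orbb (negPf ab) in ha.
Qed.

Lemma sum_adj G : (\sum_x \sum_y adj G x y = 2 * #|edges G|)%N.
Proof.
rewrite pair_big /=.
transitivity (\sum_(p : V * V | [set p.1; p.2] \in edges G) 1)%N.
  by rewrite [RHS]big_mkcond; apply: eq_bigr => p _; rewrite /adj /=; case: ifP.
rewrite (partition_big (fun p => [set p.1; p.2]) (mem (edges G))) //=.
rewrite mulnC -sum_nat_const; apply: eq_bigr => e eG.
rewrite -(card_ordered_pairs (card_edge eG)); apply: eq_bigl => p.
by case: eqP => [->|_]; rewrite ?eG ?andbT ?andbF.
Qed.

Fact induced_subproof G (A : {set V}) :
  [forall e in [set e in edges G | e \subset A],
     (e \subset verts G :&: A) && (#|e| == 2)].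
Proof.
apply/forall_inP => e; rewrite inE => /andP[eG eA].
by rewrite subsetI (edge_sub eG) eA (card_edge eG).
Qed.

Definition induced G (A : {set V}) : graph V := Graph (induced_subproof G A).

Lemma adj_induced G A x y :
  adj (induced G A) x y = [&& adj G x y, x \in A & y \in A].
Proof. by rewrite /adj /= inE subUset !sub1set. Qed.

Lemma sub_adj H G x y : subgraph H G -> adj H x y -> adj G x y.
Proof. by case/andP => _ /subsetP; apply. Qed.

Lemma adj_connect_sym G : connect_sym (adj G).
Proof. exact: sym_connect_sym (@adj_sym G). Qed.

(** Components are indexed by all of [V]: the class is empty unless [r] is the root of a vertex of
    [G]. Elements of [V] outside [verts G] also have roots, hence the explicit restriction. *)
Definition class_of G r := [set x in verts G | fingraph.root (adj G) x == r].

Lemma class_of_closed G r x y :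
  x \in class_of G r -> adj G x y -> y \in class_of G r.
Proof.
rewrite !inE => /andP[_ /eqP <-] xy; have /andP[_ ->] := adj_verts xy.
by rewrite eq_sym root_connect ?connect1 //; apply: adj_connect_sym.
Qed.

(** A path that starts in a class never leaves it, so all its edges survive in the induced graph. *)
Lemma connect_induced_class G r x y : x \in class_of G r ->
  connect (adj G) x y -> connect (adj (induced G (class_of G r))) x y.
Proof.
move=> xA /connectP[p]; elim: p x xA => [|z p IH] x xA /=.
  by move=> _ ->.
case/andP => xz pz ey; have zA := class_of_closed xA xz.
apply: connect_trans _ (IH z zA pz ey).
by apply: connect1; rewrite adj_induced xz xA.
Qed.

Lemma class_of_component G r :
  class_of G r != set0 -> is_component (induced G (class_of G r)) G.
Proof.
set A := class_of G r => A_neq0; set K := induced G A.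
have A_sub : verts G :&: A = A.
  by apply/setIidPr/subsetP => x; rewrite inE => /andP[].
have connA x y : x \in A -> y \in A -> connect (adj G) x y.
  rewrite !inE => /andP[_ /eqP rx] /andP[_ /eqP ry].
  by rewrite -root_connect ?rx ?ry //; apply: adj_connect_sym.
split.
- rewrite /subgraph /= A_sub; apply/andP; split.
    by apply/subsetP => x; rewrite inE => /andP[].
  by apply/subsetP => e; rewrite inE => /andP[].
- rewrite /connected_graph /= A_sub A_neq0.
  apply/forall_inP => x xA; apply/forall_inP => y yA.
  by apply: connect_induced_class => //; apply: connA.
(* Maximality: L contains some x of A, and paths of L are paths of G, so every vertex of L has the
   root of x. *)
- move=> L LG /andP[_ /forall_inP connL] KL.
  have [x xA] := set0Pn _ A_neq0.
  have xL : x \in verts L.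
    by case/andP: KL => /subsetP KL _; apply: KL; rewrite /= A_sub.
  have LA : verts L \subset A.
    apply/subsetP => y yL.
    have xy : connect (adj G) x y.
      have /forall_inP/(_ y yL) := connL x xL.
      by apply: connect_sub => u v uv; apply/connect1/(sub_adj LG).
    have yG : y \in verts G by case/andP: LG => /subsetP LG _; apply: LG.
    move: xA; rewrite !inE yG => /andP[_ /eqP <-].
    by rewrite eq_sym root_connect //; apply: adj_connect_sym.
  rewrite /subgraph /= A_sub LA /=; apply/subsetP => e eL.
  rewrite inE (subset_trans (edge_sub eL) LA) andbT.
  by case/andP: LG => _ /subsetP; apply.
Qed.

Lemma sum_edges_class G :
  (\sum_r #|edges (induced G (class_of G r))| = #|edges G|)%N.
Proof.
apply/eqP; rewrite -(eqn_pmul2l (isT : (0 < 2)%N)) -sum_adj big_distrr /=.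
apply/eqP; under eq_bigr => r _ do rewrite -(sum_adj (induced G (class_of G r))).
rewrite exchange_big; apply: eq_bigr => x _ /=.
rewrite exchange_big; apply: eq_bigr => y _ /=.
under eq_bigr => r _ do rewrite adj_induced.
case: (boolP (adj G x y)) => [xy|_] /=; last by rewrite big1.
(* An adjacent pair is counted only in the class of the root of x, which contains y too. *)
rewrite (bigD1 (fingraph.root (adj G) x)) //= big1 ?addn0; last first.
  by move=> r /negPf xr; rewrite !inE [fingraph.root _ x == r]eq_sym xr andbF.
have xA : x \in class_of G (fingraph.root (adj G) x).
  by have /andP[xG _] := adj_verts xy; rewrite inE xG /=.
by rewrite xA (class_of_closed xA xy).
Qed.

(** This lets [pblock P] play the role of the class map [c] in the pair counts. *)
Lemma is_parts_adj G P x y : is_parts G P -> x \in verts G -> y \in verts G ->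
  adj G x y = (pblock P x != pblock P y).
Proof.
case/and3P => PG /forall_inP indep /forall_inP full xG yG.
have [cP] := and3P PG; move=> _ _; move/eqP in cP.
have bP z : z \in verts G -> pblock P z \in P by rewrite -cP => /pblock_mem.
have zP z : z \in verts G -> z \in pblock P z by rewrite -cP mem_pblock.
have [exy|nxy] := eqVneq.
  have /forall_inP/(_ x (zP x xG))/forall_inP/(_ y) := indep _ (bP x xG).
  by rewrite exy zP // => /(_ isT)/negPf.
have /forall_inP/(_ _ (bP y yG))/implyP/(_ nxy) := full _ (bP x xG).
by move=> /forall_inP/(_ x (zP x xG))/forall_inP/(_ y (zP y yG)).
Qed.

End GraphLemmas.

(** * Combining the estimates over all components *)

Lemma sqr_sum_le (I : finType) (x : I -> nat) (m : nat) :
  (forall i, x i <= m)%N ->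
  ((\sum_i x i) ^ 2 <= m * \sum_i \sum_j minn (x i) (x j))%N.
Proof.
move=> xm; rewrite expnS expn1 big_distrlr big_distrr; apply: leq_sum => i _ /=.
rewrite big_distrr; apply: leq_sum => j _ /=.
(* The product is the minimum times the maximum, and the maximum is at most m. *)
by case: (leqP (x i)) => _; [rewrite mulnC|]; rewrite leq_mul.
Qed.

Lemma sum_minn_class_edges (V : finType) (P : {set {set V}}) (G H : graph V) :
  is_parts G P -> subgraph H G ->
  (\sum_r \sum_s minn #|edges (induced H (class_of H r))|
                      #|edges (induced H (class_of H s))| <= #|edges G|)%N.
Proof.
move=> partsP HG; set e := fun r => #|edges (induced H (class_of H r))|.
have vHG x : x \in verts H -> x \in verts G.
  by case/andP: HG => /subsetP HG _; apply: HG.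
pose N (A B : {set V}) :=
  (\sum_(x in A) \sum_(y in B) (pblock P x != pblock P y))%N.
(* Edges of H are edges of G, so their ends lie in different parts. *)
have eN r : (2 * e r <= N (class_of H r) (class_of H r))%N.
  rewrite -sum_adj /N big_mkcond [leqRHS]big_mkcond; apply: leq_sum => x _ /=.
  case: ifP => xA; last by rewrite big1 // => y _; rewrite adj_induced xA andbF.
  rewrite [leqRHS]big_mkcond; apply: leq_sum => y _.
  rewrite adj_induced xA /=; case: ifP => yA; rewrite ?andbF ?andbT //.
  have [xH yH] : x \in verts H /\ y \in verts H.
    by move: xA yA; rewrite !inE => /andP[-> _] /andP[-> _].
  rewrite -(is_parts_adj partsP) ?vHG //.
  by case: (boolP (adj H x y)) => // /(sub_adj HG) ->.
(* The classes partition [verts H], so the double sum counts the ordered pairs of vertices of H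
   adjacent in G. *)
have NG : (\sum_r \sum_s N (class_of H r) (class_of H s) <= 2 * #|edges G|)%N.
  have sumH (F : V -> nat) :
      (\sum_r \sum_(x in class_of H r) F x = \sum_(x in verts H) F x)%N.
    rewrite [RHS](partition_big (fingraph.root (adj H)) predT) //=.
    by apply: eq_bigr => r _; apply: eq_bigl => x; rewrite inE.
  under eq_bigr => r _.
    rewrite exchange_big /=.
    under eq_bigr => x _ do rewrite sumH.
    over.
  rewrite sumH -sum_adj big_mkcond; apply: leq_sum => x _.
  case: ifP => // xH; rewrite big_mkcond; apply: leq_sum => y _.
  by case: ifP => // yH; rewrite (is_parts_adj partsP) ?vHG.
rewrite -(leq_pmul2l (isT : (0 < 2)%N)); apply: leq_trans NG.
rewrite big_distrr; apply: leq_sum => r _ /=.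
rewrite big_distrr; apply: leq_sum => s _ /=.
apply: leq_trans (minn_sum_neq _ _ _); rewrite minnMr leq_min !geq_min.
by rewrite eN eN orbT.
Qed.

Theorem theorem3 (V : finType) (r : nat) (G H : graph V)
    (r_ge2 : (2 <= r)%N)
    (G_multipartite : complete_multipartite r G)
    (H_nonempty : verts H != set0)
    (H_sub_G : subgraph H G) :
  exists H' : graph V,
    is_component H' H /\
    (#|edges H'|%:R : rat) >= #|edges H|%:R ^+ 2 / #|edges G|%:R.
Proof.
have [P [partsP _]] := G_multipartite.
pose e s := #|edges (induced H (class_of H s))|.
have [x xH] := set0Pn _ H_nonempty.
have rx_neq0 : class_of H (fingraph.root (adj H) x) != set0.
  by apply/set0Pn; exists x; rewrite inE xH /=.
pose s0 := [arg max_(s > fingraph.root (adj H) x | class_of H s != set0) e s].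
(* A component must be nonempty, so the maximum is taken over nonempty classes; empty ones have no
   edges, so it bounds every [e s]. *)
have [s0_neq0 s0_max] : class_of H s0 != set0 /\ forall s, (e s <= e s0)%N.
  rewrite /s0; case: arg_maxnP => // s s_neq0 s_max; split=> // t.
  have [t0|/s_max//] := eqVneq (class_of H t) set0.
  rewrite /e t0 [leqLHS](_ : _ = 0)%N //; apply: eq_card0 => f.
  rewrite !inE subset0; apply/andP => -[fH /eqP f0].
  by have := card_edge fH; rewrite f0 cards0.
exists (induced H (class_of H s0)); split; first exact: class_of_component.
have le_sqr : (#|edges H| ^ 2 <= e s0 * #|edges G|)%N.
  rewrite -sum_edges_class (leq_trans (sqr_sum_le s0_max)) // leq_mul2l.
  by rewrite (sum_minn_class_edges partsP H_sub_G) orbT.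
(* If G has no edges, the quotient is 0 by the convention that the inverse of 0 is 0. *)
have [->|G_gt0] := posnP #|edges G|; first by rewrite invr0 mulr0 ler0n.
by rewrite ler_pdivrMr ?ltr0n // -natrX -natrM ler_nat.
Qed.
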